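(* Suppose that the interaction weights $w$ are symmetric, nonnegative, and depend only on time and the positions: $$w(t,\alpha,\beta,x_t(\alpha),x_t(\beta))=\tilde w(t,x_t(\alpha),x_t(\beta)).$$ If $\tilde w$ is Lipschitz continuous, i.e. $|\tilde w(t,x,y)-\tilde w(t,x,z)|\le L|y-z|$ for all $t,x,y,z$ and some $L$, then any solution $x_t(\alpha)$ (in the sense of the context) of $$\dot{x}_t(\alpha) = \int_{0}^{1} w(t,\alpha,\beta,x_t(\alpha),x_t(\beta))\,(x_t(\beta)-x_t(\alpha))\,d\beta$$ converges as $t\to\infty$ for almost all $\alpha$.
   Context: The weight function $w:[0,\infty)\times[0,1]\times[0,1]\times\mathbb{R}\times\mathbb{R}\to[0,\infty)$ is jointly measurable in all its variables and bounded: $w\le W$ for some constant $W<\infty$. Here $\tilde w:[0,\infty)\times\mathbb{R}\times\mathbb{R}\to[0,\infty)$ and $w(t,\alpha,\beta,x,y)=\tilde w(t,x,y)$; symmetric means $\tilde w(t,x,y)=\tilde w(t,y,x)$ for all $t,x,y$. A solution is a function $(t,\alpha)\mapsto x_t(\alpha)$ from $[0,\infty)\times[0,1]$ to $\mathbb{R}$ such that: $x_t(\cdot)$ is measurable for each $t$; for each $\alpha\in[0,1]$, $t\mapsto x_t(\alpha)$ is absolutely continuous (on bounded intervals) and the equation holds for almost all $t$; $x_0(\alpha)\in[0,1]$ for all $\alpha$; and $\sup_{\alpha\in[0,1],\,t\le T}|x_t(\alpha)|<\infty$ for every $T\ge 0$. *)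

(* Defs.v *)
From HB Require Import structures.
From mathcomp Require Import all_boot all_order all_algebra.
From mathcomp Require Import all_classical all_reals all_analysis.

Set Implicit Arguments.
Unset Strict Implicit.
Unset Printing Implicit Defensive.

Import Order.TTheory GRing.Theory Num.Theory.
Import numFieldNormedType.Exports.

Local Open Scope classical_set_scope.
Local Open Scope ring_scope.

(* [R] itself carries the Borel sigma-algebra; [lebR R] is the same carrier
   with the sigma-algebra of all Lebesgue-measurable sets, which is the domain
   of [completed_lebesgue_measure]. *)
Definition lebR (R : realType) : measurableType _ :=
  caratheodory_type (@wlength R idfun)^*%mu.
Arguments lebR : clear implicits.

Definition lebesgue (R : realType) : {measure set (lebR R) -> \bar R} :=
  @completed_lebesgue_measure R.
Arguments lebesgue : clear implicits.

Definition time (R : realType) : set R := [set` `[0, +oo[].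
Arguments time : clear implicits.

Definition label (R : realType) : set R := [set` `[0, 1]].
Arguments label : clear implicits.

(* Functions on [0, oo[, [0, 1] are represented by total functions on [R];
   hypotheses only constrain their values on the intended domain. *)

(* Joint measurability is taken Lebesgue in (t, a, b) and Borel in (x, y), so
   that b |-> w t a b (x a) (x b) is Lebesgue measurable whenever x is. *)
Definition bounded_weight (R : realType) (w : R -> R -> R -> R -> R -> R) :
    Prop :=
  measurable_fun
    (time R `*` label R `*` label R `*` [set: R] `*` [set: R] :
       set (lebR R * lebR R * lebR R * R * R)%type)
    (fun p : (lebR R * lebR R * lebR R * R * R)%type =>
       let: (t, a, b, x, y) := p in w t a b x y : R) /\
  exists W : R, forall t a b x y, time R t -> label R a -> label R b ->
    0 <= w t a b x y <= W.

Definition absolutely_continuous_on (R : realType) (c d : R) (f : R -> R) :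
    Prop :=
  forall e : R, 0 < e -> exists2 delta : R, 0 < delta &
    forall (n : nat) (a b : 'I_n -> R),
      (forall i, c <= a i <= b i /\ b i <= d) ->
      trivIset [set: 'I_n] (fun i => [set` `]a i, b i[]) ->
      \sum_(i < n) (b i - a i) < delta ->
      \sum_(i < n) `|f (b i) - f (a i)| < e.

Definition velocity (R : realType) (w : R -> R -> R -> R -> R -> R)
    (x : R -> R -> R) (t a : R) : R :=
  \int[lebesgue R]_(b in (label R : set (lebR R)))
    (w t a b (x t a) (x t b) * (x t b - x t a)).

Definition is_solution (R : realType) (w : R -> R -> R -> R -> R -> R)
    (x : R -> R -> R) : Prop :=
  [/\ forall t, time R t ->
        measurable_fun (label R : set (lebR R)) (x t : lebR R -> R),
      forall a, label R a ->
        (forall T : R, 0 <= T -> absolutely_continuous_on 0 T (x ^~ a)) /\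
        {ae lebesgue R, forall t : R, time R t ->
           is_derive t (1 : R) (x ^~ a) (velocity w x t a)},
      forall a, label R a -> 0 <= x 0 a <= 1 &
      forall T : R, 0 <= T ->
        exists M : R, forall t a, 0 <= t <= T -> label R a -> `|x t a| <= M].

(* Main.v *)
(* Two agents [a], [b] move in the same time-dependent field, which is Lipschitz
   in the position, so by Gronwall the flow [x 0 a |-> x t a] is monotone and
   bi-Lipschitz on bounded time intervals; comparison with nearly extremal agents
   keeps all positions in [0, 1].  If [A] is a set of agents lying initially below
   all the others, the interactions inside [A] cancel by symmetry and those with
   the outside push [A] upwards, so the integral of [x t] over [A] is nondecreasing
   in [t] and converges.  Hence so does the mean over any band [c1 <= x 0 <= c2].
   If two agents both oscillate across a gap [p < q], that mean would have to be at
   most [p] and at least [q] in the limit, so the band between them is null; the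
   agents oscillating across [p < q] are therefore negligible, and one takes the
   union over rational [p < q].

   Fubini is avoided: for the monotonicity of the integral over [A], the agents of
   [A] are grouped in finitely many cells of nearly equal initial position, each
   represented by one agent; the bi-Lipschitz bound controls the error. *)

Require Import Defs.
From mathcomp Require Import all_boot all_order all_algebra.
From mathcomp Require Import all_classical all_reals all_analysis measurable_realfun.
From mathcomp Require Import ring lra zify.

Set Implicit Arguments.
Unset Strict Implicit.
Unset Printing Implicit Defensive.

Import Order.TTheory GRing.Theory Num.Theory.
Import numFieldNormedType.Exports.

Local Open Scope classical_set_scope.
Local Open Scope ring_scope.

(** * Increments of absolutely continuous functions *)

(** The supremum [m] of the points satisfying [P] must be [d], since otherwise [P] extends past it.
    The extension starts from some [s] close to [m] on its left, because [P m] is not known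
    beforehand. *)
Lemma real_induction (R : realType) (c d : R) (P : R -> Prop) :
  c <= d -> P c ->
  (forall m, c <= m <= d -> exists2 r, 0 < r & forall s u,
     c <= s -> m - r < s <= m -> m <= u < m + r -> u <= d -> P s -> P u) ->
  P d.
Proof.
move=> cd Pc Pext; pose S := [set s | c <= s <= d /\ P s].
have Sc : S c by split; rewrite // lexx.
have supS : has_sup S by split; [exists c | exists d => s [/andP[]]].
have cm : c <= sup S by exact: (ub_le_sup supS.2).
have md : sup S <= d by apply: ge_sup; [exists c | move=> s [/andP[]]].
have [|r r0 Pr] := Pext (sup S); first by rewrite cm.
have [s [/andP[cs sd] Ps] rs] := sup_adherent r0 supS.
have sm : s <= sup S by apply: (ub_le_sup supS.2); split; rewrite ?cs.
have step u : sup S <= u < sup S + r -> u <= d -> P u.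
  by move=> /andP[? ?] ud; apply: (Pr s u) => //; apply/andP.
have [<-|ne] := eqVneq (sup S) d.
  by apply: step => //; rewrite lexx ltrDl.
have lt_md : sup S < d by rewrite lt_neqAle ne.
pose u := Num.min d (sup S + r / 2).
have mu : sup S < u by rewrite /u lt_min lt_md/=; lra.
have ud : u <= d by rewrite /u ge_min lexx.
have ur : u <= sup S + r / 2 by rewrite /u ge_min lexx orbT.
have : u <= sup S.
  apply: (ub_le_sup supS.2); split; first by apply/andP; split; lra.
  by apply: step => //; apply/andP; split; lra.
by move=> um; lra.
Qed.

(** The increments over [[u, t]] and [[t, v]] are bounded separately and added. Intervals straddling
    [t] are what [real_induction] asks for. *)
Lemma is_derive_increment_ge (R : realType) (f : R -> R) (t df K e : R) :
  is_derive t 1 f df -> K <= df -> 0 < e ->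
  exists2 r, 0 < r & forall u v, t - r < u <= t -> t <= v < t + r ->
    (K - e) * (v - u) <= f v - f u.
Proof.
move=> [dft dfE] Kdf e0; have := dft => /cvgrPdist_lt /(_ _ e0).
rewrite -/(derive f t 1) dfE => -[r /= r0 H].
have {}H h : `|h| < r -> h != 0 -> `|df - h^-1 * (f (h + t) - f t)| < e.
  move=> hr h0; have := H h; rewrite /= sub0r normrN => /(_ hr h0).
  by rewrite /GRing.scale/= mulr1.
exists r => // u v /andP[ru ut] /andP[tv vr].
have fv : (K - e) * (v - t) <= f v - f t.
  have [->|vt] := eqVneq v t; first by rewrite !subrr mulr0.
  have vt0 : 0 < v - t by rewrite subr_gt0 lt_neqAle eq_sym vt.
  have := H (v - t); rewrite gtr0_norm// subrK gt_eqF// => /(_ _ isT).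
  have -> : v - t < r by lra.
  move=> /(_ isT); rewrite ltr_distlC => /andP[lb _].
  rewrite -ler_pdivlMr // mulrC; lra.
have fu : (K - e) * (t - u) <= f t - f u.
  have [->|ut'] := eqVneq u t; first by rewrite !subrr mulr0.
  have ut0 : 0 < t - u by rewrite subr_gt0 lt_neqAle ut'.
  have := H (u - t); rewrite distrC gtr0_norm// subrK subr_eq0 => /(_ _ ut').
  have -> : t - u < r by lra.
  move=> /(_ isT); rewrite ltr_distlC => /andP[lb _].
  rewrite -ler_pdivlMr //.
  have -> : (f t - f u) / (t - u) = (u - t)^-1 * (f u - f t).
    by rewrite -(opprB u t) -(opprB (f u)) invrN mulrN mulNr opprK mulrC.
  lra.
have -> : v - u = (v - t) + (t - u) by ring.
by rewrite mulrDr; lra.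
Qed.

(** Such a list runs from right to left, so once the first interval is removed from [U] the others
    still lie in what remains. Half-open intervals stay disjoint when they share an endpoint. *)
Lemma sum_disjoint_itv_le_measure (R : realType) (U : set R) (l : seq (R * R)) :
  measurable U ->
  (forall p, p \in l -> p.1 <= p.2 /\ [set` `]p.1, p.2]] `<=` U) ->
  pairwise (fun p q => q.2 <= p.1) l ->
  ((\sum_(p <- l) (p.2 - p.1))%:E <= lebesgue_measure U)%E.
Proof.
elim: l U => [|p l IH] U mU lU; first by rewrite big_nil measure_ge0.
rewrite pairwise_cons => /andP[/allP pl pwl]; rewrite big_cons.
have mp : measurable ([set` `]p.1, p.2]] : set R) by exact: measurable_itv.
have [p12 pU] := lU p (mem_head _ _).
rewrite -(setDUK pU) measureU//; last 2 first.
- exact: measurableD.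
- by rewrite setDE setICA setICr setI0.
rewrite EFinD leeD//.
  rewrite [leRHS]lebesgue_measure_itv/= lte_fin.
  by case: ltP => // p21; rewrite lee_fin; lra.
apply: IH => //; first exact: measurableD.
move=> q ql; have [q12 qU] := lU q (mem_behead (s := p :: l) ql).
split=> // y yq; split; first exact: qU.
move: yq => /=; rewrite !in_itv/= => /andP[qy yq] /andP[py _].
by have := pl _ ql; lra.
Qed.

(** Ordered lists grow by one interval at the head, which suits an inductive construction better
    than disjoint families indexed by ['I_n]. *)
Lemma absolutely_continuous_seq (R : realType) (c d : R) (f : R -> R) (e : R) :
  absolutely_continuous_on c d f -> 0 < e ->
  exists2 delta : R, 0 < delta & forall l : seq (R * R),
    (forall p, p \in l -> c <= p.1 <= p.2 /\ p.2 <= d) ->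
    pairwise (fun p q => q.2 <= p.1) l ->
    \sum_(p <- l) (p.2 - p.1) < delta ->
    \sum_(p <- l) `|f p.2 - f p.1| < e.
Proof.
move=> fac e0; have [delta d0 H] := fac e e0; exists delta => // l lcd pwl.
rewrite !(big_nth (0, 0)) !big_mkord => suml.
apply: (H _ (fun i => (nth (0, 0) l i).1) (fun i => (nth (0, 0) l i).2)) => //.
  by move=> i; apply: lcd; exact: mem_nth.
have disj (i j : 'I_(size l)) y : (i < j)%N ->
    y \in `](nth (0, 0) l i).1, (nth (0, 0) l i).2[ ->
    y \in `](nth (0, 0) l j).1, (nth (0, 0) l j).2[ -> False.
  move=> ij; rewrite !in_itv/= => /andP[iy _] /andP[_ yj].
  have /(pairwiseP (0, 0))/(_ i j (ltn_ord i) (ltn_ord j) ij) := pwl.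
  by lra.
move=> i j _ _ [y [yi yj]]; apply/val_inj.
by case: (ltngtP i j) => // ij; [case: (disj i j y)|case: (disj j i y)].
Qed.

(** This plays the part of the fundamental theorem of calculus. The exceptional null set is covered
    by an open set of measure below [delta], so that by absolute continuity the intervals placed
    there contribute less than [e]; elsewhere the derivative controls the increments. *)
Lemma ac_increment_ge (R : realType) (c d K : R) (f : R -> R) :
  c <= d -> 0 <= K -> absolutely_continuous_on c d f ->
  {ae lebesgue R, forall t : R, c <= t <= d ->
    exists2 df, is_derive t 1 f df & - K <= df} ->
  - K * (d - c) <= f d - f c.
Proof.
move=> cd K0 fac [N [mN N0 subN]].
suff H e : 0 < e -> (- K - e) * (d - c) - e <= f d - f c.
  apply/ler_addgt0Pr => e e0.
  have dc0 : 0 < d - c + 1 by lra.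
  (* Dividing by [d - c + 1] makes the two error terms add up to exactly [e]. *)
  have := H (e / (d - c + 1)) (divr_gt0 e0 dc0).
  have -> : (- K - e / (d - c + 1)) * (d - c) - e / (d - c + 1)
    = - K * (d - c) - e by field; rewrite gt_eqF.
  lra.
move=> e0; have [delta delta0 Hd] := absolutely_continuous_seq fac e0.
have [U [oU NU leU]] : exists U : set R,
    [/\ open U, N `<=` U & (lebesgue_measure U <= (delta / 2)%:E)%E].
  have [|U [? ? UN]] := @outer_measure_open_le R N (delta / 2).
    by rewrite divr_gt0.
  exists U; split => //; apply: (le_trans UN).
  by rewrite -[X in (X + _)%E]/(lebesgue R N) N0 add0e.
(* Real induction on [s]: a step around a good point costs [e] per unit length,
   a step around a point of [N] is charged to an interval inside [U]. *)
pose P s := exists l : seq (R * R), [/\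
  forall p, p \in l -> [/\ c <= p.1, p.1 <= p.2, p.2 <= s &
     [set` `]p.1, p.2]] `<=` U],
  pairwise (fun p q => q.2 <= p.1) l &
  (- K - e) * (s - c) - \sum_(p <- l) `|f p.2 - f p.1| <= f s - f c].
have [l [lP pwl fl]] : P d.
  apply: (@real_induction R c d) => //.
    by exists [::]; split => //; rewrite big_nil !subrr mulr0 subr0.
  move=> m cmd; have [mN'|mN'] := pselect (N m).
    have /nbhs_ballP[r /= r0 rU] : nbhs m U.
      by apply: open_nbhs_nbhs; split => //; exact: NU.
    exists r => // s u cs sm mu ud [l [lP pwl fl]].
    exists ((s, u) :: l); split.
    - move=> p; rewrite inE => /orP[/eqP->/=|pl]; last first.
        by have [? ? ? ?] := lP p pl; split => //; lra.
      split => //; [lra|]; move=> y/=; rewrite in_itv/= => sy; apply: rU.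
      by rewrite /ball/= ltr_distlC; lra.
    - rewrite pairwise_cons pwl andbT; apply/allP => p pl.
      by have [] := lP p pl.
    - rewrite big_cons /=.
      have /ler_normlP[] := lexx `|f u - f s|.
      (* Since [- K - e] is negative, the linear term only helps on an interval charged to [U]. *)
      have : (- K - e) * (u - s) <= 0 by apply: mulr_le0_ge0; lra.
      lra.
  have [df dfm Kdf] : exists2 df, is_derive m 1 f df & - K <= df.
    by apply: contrapT => nd; apply: mN'; apply: subN => /(_ cmd).
  have [r r0 Hr] := is_derive_increment_ge dfm Kdf e0.
  exists r => // s u cs sm mu ud [l [lP pwl fl]]; exists l; split => //.
    by move=> p /lP[? ? ? ?]; split => //; lra.
  by have := Hr s u sm mu; lra.
have suml : \sum_(p <- l) (p.2 - p.1) < delta.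
  rewrite -lte_fin; apply: (@le_lt_trans _ _ (delta / 2)%:E); last first.
    by rewrite lte_fin; lra.
  apply: le_trans leU; apply: sum_disjoint_itv_le_measure => //.
    exact: open_measurable.
  by move=> p /lP[].
suff : \sum_(p <- l) `|f p.2 - f p.1| < e by lra.
by apply: Hd => // p /lP[? ? ? ?]; split => //; apply/andP.
Qed.

#[local] Instance ae_lebesgue_filter (R : realType) :
  Filter (nbhs (almost_everywhere (lebesgue R))).
Proof. exact: (ae_filter_ringOfSetsType (lebesgue R)). Qed.

Lemma absolutely_continuous_onS (R : realType) (c d c' d' : R) (f : R -> R) :
  c <= c' -> d' <= d ->
  absolutely_continuous_on c d f -> absolutely_continuous_on c' d' f.
Proof.
move=> cc' dd' fac e e0; have [delta delta0 H] := fac e e0.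
exists delta => // n a b ab; apply: H => i.
by have [/andP[ca ->]] := ab i; rewrite (le_trans cc' ca); split=> //; lra.
Qed.

Lemma absolutely_continuous_onN (R : realType) (c d : R) (f : R -> R) :
  absolutely_continuous_on c d f -> absolutely_continuous_on c d (- f).
Proof.
move=> fac e e0; have [delta delta0 H] := fac e e0.
exists delta => // n a b ab tI s; apply: le_lt_trans (H n a b ab tI s).
by apply: ler_sum => i _; rewrite !fctE -opprD normrN.
Qed.

(** Solutions have this property because their velocity is bounded on bounded time intervals. It
    passes to products and implies absolute continuity, which is how the products in the Gronwall
    argument are handled. *)
Definition lipschitz_itv (R : realType) (c d K : R) (f : R -> R) :=
  forall s t, c <= s <= d -> c <= t <= d -> `|f t - f s| <= K * `|t - s|.

Lemma lipschitz_itv_ac (R : realType) (c d K : R) (f : R -> R) :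
  lipschitz_itv c d K f -> absolutely_continuous_on c d f.
Proof.
move=> fK e e0; have K0 : 0 < `|K| + 1 by rewrite ltr_wpDl.
exists (e / (`|K| + 1)); first exact: divr_gt0.
move=> n a b ab _; rewrite ltr_pdivlMr // mulrC mulr_sumr.
apply: le_lt_trans; apply: ler_sum => i _; have [/andP[ca le_ab] bd] := ab i.
apply: le_trans (fK (a i) (b i) _ _) _; rewrite ?ca//=; try lra.
rewrite ger0_norm ?subr_ge0// ler_wpM2r ?subr_ge0//.
by apply: le_trans (ler_norm K) _; lra.
Qed.

Lemma ac_lipschitz_itv (R : realType) (c d K : R) (f : R -> R) :
  0 <= K -> absolutely_continuous_on c d f ->
  {ae lebesgue R, forall t : R, c <= t <= d ->
    exists2 df, is_derive t 1 f df & `|df| <= K} ->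
  lipschitz_itv c d K f.
Proof.
move=> K0 fac fder s t; wlog st : s t / s <= t.
  move=> H hs ht; case: (leP s t) => [|/ltW] ?; first exact: H.
  by rewrite distrC (distrC t); apply: H.
move=> /andP[cs sd] /andP[ct td]; rewrite (ger0_norm (_ : 0 <= t - s)) ?subr_ge0//.
have lo : - K * (t - s) <= f t - f s.
  apply: ac_increment_ge => //; first exact: absolutely_continuous_onS fac.
  move: fder; apply: filterS => u H /andP[su ut].
  have [|df dfu dfK] := H; first by lra.
  by exists df => //; have /ler_normlP[] := dfK; lra.
have hi : - K * (t - s) <= (- f) t - (- f) s.
  apply: ac_increment_ge => //.
    exact/absolutely_continuous_onN/(absolutely_continuous_onS _ _ fac).
  move: fder; apply: filterS => u H /andP[su ut].
  have [|df dfu dfK] := H; first by lra.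
  by exists (- df); [exact: is_deriveN|rewrite lerN2; case/ler_normlP: dfK].
by move: hi; rewrite !fctE ler_norml; lra.
Qed.

Lemma lipschitz_itvM (R : realType) (c d A B K L : R) (f g : R -> R) :
  (forall t, c <= t <= d -> `|f t| <= A) ->
  (forall t, c <= t <= d -> `|g t| <= B) ->
  lipschitz_itv c d K f -> lipschitz_itv c d L g ->
  lipschitz_itv c d (A * L + B * K) (f * g).
Proof.
move=> fA gB fK gL s t hs ht.
have -> : (f * g) t - (f * g) s = f t * (g t - g s) + g s * (f t - f s).
  by rewrite !fctE; ring.
apply: le_trans (ler_normD _ _) _; rewrite !normrM mulrDl -!mulrA.
by apply: lerD; apply: ler_pM => //; [exact: fA|exact: gL|exact: gB|exact: fK].
Qed.

Lemma lipschitz_itv_expR (R : realType) (c d k : R) :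
  exists K, lipschitz_itv c d K (fun t => expR (k * t)).
Proof.
exists (expR (`|k| * (`|c| + `|d|)) * `|k|) => s t.
have bd u : c <= u <= d -> k * u <= `|k| * (`|c| + `|d|).
  move=> /andP[cu ud]; apply: le_trans (ler_norm _) _; rewrite normrM.
  apply: ler_wpM2l => //; rewrite ler_norml.
  have := ler_norm d; have := ler_norm (- c); rewrite normrN.
  by have := normr_ge0 c; have := normr_ge0 d; lra.
have key u v : c <= u <= d -> c <= v <= d ->
    expR (k * u) - expR (k * v) <= expR (`|k| * (`|c| + `|d|)) * `|k| * `|u - v|.
  move=> hu hv.
  (* Factoring out [expR (k * u)] leaves [1 - expR (k * (v - u))], which is bounded through
     [1 + z <= expR z]. *)
  have -> : expR (k * v) = expR (k * u) * expR (k * (v - u)).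
    by rewrite -expRD; congr expR; ring.
  rewrite -{1}[expR (k * u)]mulr1 -mulrBr -mulrA.
  have le1 : 1 - expR (k * (v - u)) <= `|k| * `|u - v|.
    have := expR_ge1Dx (k * (v - u)); rewrite -normrM.
    have := ler_norm (k * (u - v)); have -> : k * (u - v) = - (k * (v - u)) by ring.
    lra.
  apply: le_trans (ler_wpM2l (expR_ge0 _) le1) _.
  by rewrite ler_wpM2r ?mulr_ge0// ler_expR bd.
by move=> hs ht; rewrite ler_norml lerNl opprB {1}distrC !key.
Qed.

Lemma lipschitz_itvZ (R : realType) (c d K s : R) (f : R -> R) :
  lipschitz_itv c d K f -> lipschitz_itv c d (`|s| * K) (s \*: f).
Proof.
move=> fK u v hu hv; rewrite /= -scalerBr normrZ -mulrA.
by rewrite ler_wpM2l// fK.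
Qed.

Lemma lipschitz_itv_bounded (R : realType) (c d K t : R) (f : R -> R) :
  lipschitz_itv c d K f -> c <= t <= d -> `|f t| <= `|f c| + `|K| * (d - c).
Proof.
move=> fK /andP[ct td]; rewrite -[f t](subrKC (f c)).
apply: le_trans (ler_normD _ _) _; rewrite lerD2l.
apply: le_trans (fK c t _ _) _; rewrite ?lexx ?ct// ?(le_trans ct td)//.
rewrite ger0_norm ?subr_ge0//.
apply: le_trans (ler_wpM2r _ (ler_norm K)) _; first by rewrite subr_ge0.
by rewrite ler_wpM2l// lerB.
Qed.

Lemma is_derive_expRM (R : realType) (k t : R) :
  is_derive t 1 (fun u => expR (k * u)) (k * expR (k * t)).
Proof.
rewrite mulrC; apply: (@is_derive1_comp _ expR (k \*: id)).
apply: is_derive_eq; exact: mulr1.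
Qed.

(* [s exp (2 s C t) f(t)^2] is nondecreasing for both signs [s]. *)
Lemma gronwall_sqr (R : realType) (T C K : R) (f : R -> R) :
  0 <= T -> lipschitz_itv 0 T K f ->
  {ae lebesgue R, forall t : R, 0 <= t <= T ->
    exists2 df, is_derive t 1 f df & `|df| <= C * `|f t|} ->
  f T ^+ 2 <= expR (2 * C * T) * f 0 ^+ 2 /\
  f 0 ^+ 2 <= expR (2 * C * T) * f T ^+ 2.
Proof.
move=> T0 fK fder.
have mono (s : R) : s = 1 \/ s = -1 ->
    s * f 0 ^+ 2 <= s * (expR (2 * s * C * T) * f T ^+ 2).
  move=> s1; have ss : s * s = 1 by case: s1 => ->; ring.
  pose k := 2 * s * C; pose E t := expR (k * t).
  pose h := s \*: (E * (f * f)).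
  have hE t : h t = s * (E t * f t ^+ 2) by rewrite /h /= expr2.
  have [KE EK] := lipschitz_itv_expR 0 T k.
  have hac : absolutely_continuous_on 0 T h.
    have fB t := lipschitz_itv_bounded fK (t := t).
    have EB t := lipschitz_itv_bounded EK (t := t).
    have ffK := lipschitz_itvM fB fB fK fK.
    have ffB t := lipschitz_itv_bounded ffK (t := t).
    exact: (lipschitz_itv_ac (lipschitz_itvZ s (lipschitz_itvM EB ffB EK ffK))).
  have : - 0 * (T - 0) <= h T - h 0.
    apply: ac_increment_ge => //; move: fder; apply: filterS => t H t0T.
    have [df dft dfC] := H t0T.
    have dE : is_derive t 1 E (k * E t) := is_derive_expRM k t.
    exists (s *: (E t *: (f t *: df + f t *: df) + (f t * f t) *: (k * E t))).
      apply: is_deriveZ; apply: is_deriveM.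
    (* With [k = 2 * s * C] the exponential factor contributes [C f^2 s^2 = C f^2], which dominates
       [s f f'] for either sign of [s]. *)
    have -> : s *: (E t *: (f t *: df + f t *: df) + (f t * f t) *: (k * E t)) =
        2 * E t * (C * (f t * f t) * (s * s) + s * (f t * df)).
      by rewrite /k /GRing.scale/=; ring.
    rewrite oppr0 ss mulr1 mulr_ge0// ?mulr_ge0// ?expR_ge0//.
    have : `|s * (f t * df)| <= C * (f t * f t).
      have -> : `|s * (f t * df)| = `|f t| * `|df|.
        by rewrite !normrM; case: s1 => ->; rewrite ?normrN normr1 mul1r.
      apply: le_trans (ler_wpM2l (normr_ge0 _) dfC) _.
      rewrite mulrCA -normrM ger0_norm// -expr2; exact: sqr_ge0.
    by rewrite ler_norml; lra.
  by rewrite !hE /E mulr0 expR0 oppr0 mul0r subr_ge0 mul1r.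
split; last by have := mono 1 (or_introl erefl); rewrite !mul1r mulr1.
have := mono (-1) (or_intror erefl); rewrite !mulN1r lerN2.
have -> : 2 * -1 * C * T = - (2 * C * T) by ring.
by rewrite expRN mulrC ler_pdivrMr ?expR_gt0// mulrC.
Qed.

(** * Integrals over sets of labels *)

Lemma lebesgue_label (R : realType) : lebesgue R (label R) = 1%E.
Proof.
by have := @lebesgue_measure_itv R `[0, 1]; rewrite /= lte_fin ltr01 sube0 => <-.
Qed.

Lemma measurable_label (R : realType) : measurable (label R : set (lebR R)).
Proof. by apply: sub_caratheodory; exact: (@measurable_itv R `[0, 1]). Qed.

Lemma lebesgue_sub_label_lty (R : realType) (D : set (lebR R)) :
  measurable D -> D `<=` label R -> (lebesgue R D < +oo)%E.
Proof.
move=> mD Dl; apply: (@le_lt_trans _ _ (lebesgue R (label R))).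
  by apply: le_measure => //; rewrite inE//; exact: measurable_label.
by rewrite lebesgue_label ltry.
Qed.

Lemma lebesgue_sub_label_le1 (R : realType) (D : set (lebR R)) :
  measurable D -> D `<=` label R -> fine (lebesgue R D) <= 1.
Proof.
move=> mD Dl; rewrite -lee_fin fineK ?ge0_fin_numE ?lebesgue_sub_label_lty//.
rewrite -(lebesgue_label R); apply: le_measure => //; rewrite inE//.
exact: measurable_label.
Qed.

Lemma bounded_integrable_label (R : realType) (D : set (lebR R)) (K : R)
    (f : lebR R -> R) :
  measurable D -> D `<=` label R -> measurable_fun D f ->
  (forall b, D b -> `|f b| <= K) -> (lebesgue R).-integrable D (EFin \o f).
Proof.
move=> mD Dl mf fK; apply: measurable_bounded_integrable => //.
  exact: lebesgue_sub_label_lty.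
exists K; split; first exact: num_real.
by move=> y Ky b Db; apply: le_trans (fK b Db) _; exact: ltW.
Qed.

Lemma integrable_cst_EFin d (T : measurableType d) (R : realType)
    (mu : {measure set T -> \bar R}) (D : set T) (c : R) :
  measurable D -> (mu D < +oo)%E -> mu.-integrable D (EFin \o cst c).
Proof.
move=> mD Dfin; apply: measurable_bounded_integrable => //.
by exists `|c|; split => [|y cy b _]; [exact: num_real|exact: ltW].
Qed.

Lemma Rintegral_ge_cst d (T : measurableType d) (R : realType)
    (mu : {measure set T -> \bar R}) (D : set T) (f : T -> R) (c : R) :
  measurable D -> (mu D < +oo)%E -> mu.-integrable D (EFin \o f) ->
  (forall b, D b -> c <= f b) -> c * fine (mu D) <= \int[mu]_(b in D) f b.
Proof.
move=> mD Dfin fint cf; rewrite -Rintegral_cst//.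
by apply: le_Rintegral => //; exact: integrable_cst_EFin.
Qed.

Lemma Rintegral_le_cst d (T : measurableType d) (R : realType)
    (mu : {measure set T -> \bar R}) (D : set T) (f : T -> R) (c : R) :
  measurable D -> (mu D < +oo)%E -> mu.-integrable D (EFin \o f) ->
  (forall b, D b -> f b <= c) -> \int[mu]_(b in D) f b <= c * fine (mu D).
Proof.
move=> mD Dfin fint fc; rewrite -Rintegral_cst//.
by apply: le_Rintegral => //; exact: integrable_cst_EFin.
Qed.

(** On each cell the integral of [f] is compared with that of the constant [h i]; the cells being
    disjoint, the errors add up to [eta] times the total measure. This turns integrals over labels
    into finite sums. *)
Lemma Rintegral_cells d (T : measurableType d) (R : realType)
    (mu : {measure set T -> \bar R}) (E : nat -> set T) (n : nat) (f : T -> R)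
    (h : nat -> R) (eta : R) :
  let D := \big[setU/set0]_(i < n) E i in
  (forall i, measurable (E i)) -> trivIset [set: nat] E ->
  (mu D < +oo)%E -> mu.-integrable D (EFin \o f) ->
  (forall i b, E i b -> `|f b - h i| <= eta) ->
  `|\int[mu]_(b in D) f b - \sum_(i < n) fine (mu (E i)) * h i|
    <= eta * fine (mu D).
Proof.
move=> D mE tE Dfin fint fh; rewrite {}/D in Dfin fint *.
elim: n => [|n IH] in Dfin fint *.
  by rewrite !big_ord0 Rintegral_set0 measure0 mulr0 subrr normr0.
rewrite !big_ord_recr/= in Dfin fint *.
set D := \big[setU/set0]_(i < n) E i in IH Dfin fint *.
have mD : measurable D by exact: bigsetU_measurable.
have dDE : [disjoint D & E n].
  apply/disj_setPS => b [+ Enb]; rewrite /D -bigcup_mkord => -[i /= ltin Eib].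
  by have := tE i n I I (ex_intro _ b (conj Eib Enb)); lia.
have finD : (mu D < +oo)%E.
  by apply: le_lt_trans Dfin; apply: le_measure; rewrite ?inE//; exact: measurableU.
have finE : (mu (E n) < +oo)%E.
  by apply: le_lt_trans Dfin; apply: le_measure; rewrite ?inE//; exact: measurableU.
have intE : mu.-integrable (E n) (EFin \o f).
  by apply: integrableS fint => //; exact: measurableU.
have intD : mu.-integrable D (EFin \o f).
  by apply: integrableS fint => //; exact: measurableU.
have {}IH := IH finD intD.
rewrite Rintegral_setU// measureU//; last exact/disj_set2P.
rewrite fineD ?ge0_fin_numE// mulrDr opprD addrACA.
apply: le_trans (ler_normD _ _) _; apply: lerD => //.
have -> : fine (mu (E n)) * h n = \int[mu]_(b in E n) h n.
  by rewrite Rintegral_cst// mulrC.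
rewrite -RintegralB//; last exact: integrable_cst_EFin.
have intB : mu.-integrable (E n) (EFin \o (fun b => f b - h n)).
  have := integrableB (mE n) intE (integrable_cst_EFin (h n) (mE n) finE).
  exact: eq_integrable.
rewrite ler_norml -mulNr; apply/andP; split.
  apply: Rintegral_ge_cst => // b Eb.
  by have := fh _ _ Eb; rewrite ler_norml => /andP[].
apply: Rintegral_le_cst => // b Eb.
by have := fh _ _ Eb; rewrite ler_norml => /andP[].
Qed.

(** * Solutions of the symmetric model *)

Section interaction_field.
Context (R : realType) (wt : R -> R -> R -> R) (x : R -> R -> R) (W L : R).
Hypothesis wt_bounded : forall t y z : R, 0 <= t -> 0 <= wt t y z <= W.
Hypothesis wt_sym : forall t y z : R, 0 <= t -> wt t y z = wt t z y.
Hypothesis L_ge0 : 0 <= L.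
Hypothesis wt_lip :
  forall t y z u : R, 0 <= t -> `|wt t y z - wt t y u| <= L * `|z - u|.
Hypothesis x_measurable : forall t : R, 0 <= t ->
  measurable_fun (label R : set (lebR R)) (x t : lebR R -> R).
Hypothesis x_bounded : forall T : R, 0 <= T ->
  exists M : R, forall t a : R, 0 <= t <= T -> label R a -> `|x t a| <= M.

(** * Estimates on the interaction field *)

Definition influence (t y b : R) := wt t y (x t b) * (x t b - y).

Definition field (t y : R) : R :=
  \int[lebesgue R]_(b in (label R : set (lebR R))) influence t y b.

Let W_ge0 : 0 <= W.
Proof. by have /andP[] := wt_bounded 0 0 (lexx 0); exact: le_trans. Qed.

Let normr_wt t y z : 0 <= t -> `|wt t y z| <= W.
Proof.
by move=> t0; have /andP[w0 wW] := wt_bounded y z t0; rewrite ger0_norm.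
Qed.

(** The Lipschitz bound makes [wt t y] continuous, and its composition with the measurable [x t] is
    measurable. *)
Lemma measurable_influence (t y : R) (D : set (lebR R)) :
  0 <= t -> measurable D -> D `<=` label R ->
  measurable_fun D (influence t y : lebR R -> R).
Proof.
move=> t0 mD Dl.
have mx : measurable_fun D (x t : lebR R -> R).
  by apply: measurable_funS (x_measurable t0) => //; exact: measurable_label.
apply: measurable_funM; last exact: measurable_funB.
apply: (measurableT_comp _ mx); apply: continuous_measurable_fun => z.
apply/cvgrPdist_lt => e e0; near=> u.
apply: le_lt_trans (wt_lip _ _ _ t0) _.
(* Dividing by [L + 1] instead of [L] covers the case [L = 0]. *)
have : `|z - u| < e / (L + 1).
  by near: u; apply: cvgr_dist_lt => //; rewrite divr_gt0// ltr_wpDl.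
rewrite ltr_pdivlMr ?ltr_wpDl// mulrC mulrDl mul1r.
have := normr_ge0 (z - u); lra.
Unshelve. all: by end_near. Qed.

Lemma normr_influence_le (t y b M : R) :
  0 <= t -> `|x t b| <= M -> `|y| <= M -> `|influence t y b| <= W * (2 * M).
Proof.
move=> t0 xM yM; rewrite normrM; apply: ler_pM => //; first exact: normr_wt.
by apply: le_trans (ler_normB _ _) _; lra.
Qed.

Lemma influence_integrable (t y : R) (D : set (lebR R)) :
  0 <= t -> measurable D -> D `<=` label R ->
  (lebesgue R).-integrable D (EFin \o influence t y).
Proof.
move=> t0 mD Dl; have [M xM] := x_bounded t0.
apply: (@bounded_integrable_label _ _ (W * (2 * (M + `|y|)))) => //.
  exact: measurable_influence.
move=> b Db; have := xM t b; rewrite t0 lexx => /(_ isT (Dl _ Db)) xbM.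
apply: normr_influence_le => //; first by rewrite ler_wpDr.
by rewrite ler_wpDl// (le_trans _ xbM).
Qed.

Lemma field_le (t y c : R) : 0 <= t ->
  (forall b, label R b -> influence t y b <= c) -> field t y <= c.
Proof.
move=> t0 fc.
have -> : c = c * fine (lebesgue R (label R)) by rewrite lebesgue_label mulr1.
apply: Rintegral_le_cst => //; first exact: measurable_label.
  by rewrite lebesgue_label ltry.
by apply: influence_integrable => //; exact: measurable_label.
Qed.

Lemma field_ge (t y c : R) : 0 <= t ->
  (forall b, label R b -> c <= influence t y b) -> c <= field t y.
Proof.
move=> t0 fc.
have -> : c = c * fine (lebesgue R (label R)) by rewrite lebesgue_label mulr1.
apply: Rintegral_ge_cst => //; first exact: measurable_label.
  by rewrite lebesgue_label ltry.
by apply: influence_integrable => //; exact: measurable_label.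
Qed.

Lemma normr_field_le (t y M : R) : 0 <= t ->
  (forall b, label R b -> `|x t b| <= M) -> `|y| <= M ->
  `|field t y| <= W * (2 * M).
Proof.
move=> t0 xM yM; rewrite ler_norml; apply/andP; split.
  apply: field_ge => // b lb.
  by have := normr_influence_le t0 (xM b lb) yM; rewrite ler_norml => /andP[].
apply: field_le => // b lb.
by have := normr_influence_le t0 (xM b lb) yM; rewrite ler_norml => /andP[].
Qed.

Lemma influence_lip_target (t y b b' M : R) : 0 <= t ->
  `|x t b| <= M -> `|y| <= M ->
  `|influence t y b - influence t y b'| <= (L * (2 * M) + W) * `|x t b - x t b'|.
Proof.
move=> t0 xM yM.
have -> : influence t y b - influence t y b' =
    (wt t y (x t b) - wt t y (x t b')) * (x t b - y) +
    wt t y (x t b') * (x t b - x t b') by rewrite /influence; ring.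
apply: le_trans (ler_normD _ _) _; rewrite !normrM mulrDl.
apply: lerD; last by rewrite ler_wpM2r// normr_wt.
rewrite mulrAC; apply: ler_pM => //; first exact: wt_lip.
by apply: le_trans (ler_normB _ _) _; lra.
Qed.

(** Symmetry of [wt] carries the Lipschitz bound over from its last argument to the position of the
    influenced agent. *)
Lemma influence_lip_source (t y y' b M : R) : 0 <= t ->
  `|x t b| <= M -> `|y| <= M ->
  `|influence t y b - influence t y' b| <= (L * (2 * M) + W) * `|y - y'|.
Proof.
move=> t0 xM yM.
have -> : influence t y b - influence t y' b =
    (wt t y (x t b) - wt t y' (x t b)) * (x t b - y) +
    wt t y' (x t b) * (y' - y) by rewrite /influence; ring.
apply: le_trans (ler_normD _ _) _; rewrite !normrM mulrDl.
apply: lerD; last by rewrite (distrC y') ler_wpM2r// normr_wt.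
rewrite mulrAC (wt_sym y)// (wt_sym y')//; apply: ler_pM => //; first exact: wt_lip.
by apply: le_trans (ler_normB _ _) _; lra.
Qed.

Lemma field_lip (t y y' M : R) : 0 <= t ->
  (forall b, label R b -> `|x t b| <= M) -> `|y| <= M ->
  `|field t y - field t y'| <= (L * (2 * M) + W) * `|y - y'|.
Proof.
move=> t0 xM yM.
have ml : measurable (label R : set (lebR R)) by exact: measurable_label.
have lfin : (lebesgue R (label R) < +oo)%E by rewrite lebesgue_label ltry.
have int y0 : (lebesgue R).-integrable (label R : set (lebR R)) (EFin \o influence t y0).
  exact: influence_integrable.
rewrite /field -RintegralB//.
have intB := integrableB ml (int y) (int y').
set c := (_ + _) * _.
have -> : c = c * fine (lebesgue R (label R)) by rewrite lebesgue_label mulr1.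
have bd b : label R b -> - c <= influence t y b - influence t y' b <= c.
  by move=> lb; rewrite -ler_norml; apply: influence_lip_source => //; exact: xM.
rewrite ler_norml -mulNr; apply/andP; split.
  by apply: Rintegral_ge_cst => // b /bd /andP[].
by apply: Rintegral_le_cst => // b /bd /andP[].
Qed.

(** * Comparison of trajectories *)

Hypothesis x_ac : forall a, label R a ->
  forall T : R, 0 <= T -> absolutely_continuous_on 0 T (x ^~ a).
Hypothesis x_derive : forall a, label R a ->
  {ae lebesgue R, forall t : R, 0 <= t ->
    is_derive t (1 : R) (x ^~ a) (field t (x t a))}.

Lemma solution_lipschitz (T M a : R) : 0 <= T ->
  (forall t b, 0 <= t <= T -> label R b -> `|x t b| <= M) -> label R a ->
  lipschitz_itv 0 T (W * (2 * M)) (x ^~ a).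
Proof.
move=> T0 xM la; apply: ac_lipschitz_itv.
- have : `|x 0 a| <= M by apply: xM; rewrite ?lexx.
  by move=> /(le_trans (normr_ge0 _)) M0; rewrite !mulr_ge0.
- exact: x_ac.
- move: (x_derive la); apply: filterS => t xt /andP[t0 tT].
  exists (field t (x t a)); first exact: xt.
  apply: normr_field_le => //; last by apply: xM; rewrite ?t0.
  by move=> b; apply: xM; rewrite t0.
Qed.

(** By [field_lip] the difference [f] of two trajectories satisfies [|f'| <= C |f|] almost
    everywhere. Gronwall's inequality in both time directions bounds [f^2], and [expR (|C| * T)] is
    the square root of the resulting factor at time [T]. *)
Lemma flow_bilipschitz (T : R) : 0 <= T ->
  exists2 k : R, 0 < k & forall t a b, 0 <= t <= T -> label R a -> label R b ->
    `|x t b - x t a| <= k * `|x 0 b - x 0 a| /\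
    `|x 0 b - x 0 a| <= k * `|x t b - x t a|.
Proof.
move=> T0; have [M xM] := x_bounded T0.
pose C := L * (2 * M) + W; exists (expR (`|C| * T)); first exact: expR_gt0.
move=> t a b /andP[t0 tT] la lb.
pose f u := x u b - x u a.
have xMt u c : 0 <= u <= t -> label R c -> `|x u c| <= M.
  by move=> /andP[u0 ut]; apply: xM; rewrite u0 (le_trans ut).
have flip : lipschitz_itv 0 t (W * (2 * M) + W * (2 * M)) f.
  move=> r s hr hs.
  have -> : f s - f r = (x s b - x r b) - (x s a - x r a) by rewrite /f; ring.
  apply: le_trans (ler_normB _ _) _; rewrite mulrDl.
  apply: lerD; first exact: (solution_lipschitz t0 xMt lb).
  exact: (solution_lipschitz t0 xMt la).
have fder : {ae lebesgue R, forall s : R, 0 <= s <= t ->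
    exists2 df, is_derive s 1 f df & `|df| <= `|C| * `|f s|}.
  move: (x_derive la) (x_derive lb); apply: filterS2 => s da db /andP[s0 st].
  exists (field s (x s b) - field s (x s a)).
    by apply: (is_deriveB (f := x ^~ b) (g := x ^~ a)); [exact: db|exact: da].
  apply: (@le_trans _ _ (C * `|f s|)); last by rewrite ler_wpM2r// ler_norm.
  apply: field_lip => //; last by apply: xMt; rewrite ?s0.
  by move=> c; apply: xMt; rewrite s0.
have [ft0 f0t] := gronwall_sqr t0 flip fder.
have le_exp : expR (2 * `|C| * t) <= expR (`|C| * T) ^+ 2.
  by rewrite -expRM_natl ler_expR -mulrA ler_wpM2l// ler_wpM2l.
have sq u v : u ^+ 2 <= expR (2 * `|C| * t) * v ^+ 2 ->
    `|u| <= expR (`|C| * T) * `|v|.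
  move=> uv; rewrite -[leRHS]ger0_norm; last by rewrite mulr_ge0// expR_ge0.
  rewrite -(@ler_pXn2r _ 2)// ?nnegrE// real_normK ?num_real//.
  rewrite real_normK ?num_real// exprMn real_normK ?num_real//.
  by apply: le_trans uv _; rewrite ler_wpM2r ?sqr_ge0.
by split; exact: sq.
Qed.

(** Equal initial positions stay equal by the upper bound of the flow. Otherwise the lower bound
    keeps the gap at least [d] as long as the order persists, and the gap cannot close within a time
    step of fixed length, so real induction reaches [t]. *)
Lemma flow_monotone (t a b : R) : 0 <= t -> label R a -> label R b ->
  x 0 a <= x 0 b -> x t a <= x t b.
Proof.
move=> t0 la lb; have [k k0 flow] := flow_bilipschitz t0.
rewrite le_eqVlt => /predU1P[xab|xab].
  have t0t : 0 <= t <= t by rewrite t0 lexx.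
  have [+ _] := flow t a b t0t la lb.
  by rewrite xab subrr normr0 mulr0 normr_le0 subr_eq0 => /eqP->.
have [M xM] := x_bounded t0.
pose K := W * (2 * M) + W * (2 * M).
have K0 : 0 <= K.
  have : `|x 0 a| <= M by apply: xM; rewrite ?lexx ?t0.
  by move=> /(le_trans (normr_ge0 _)) M0; rewrite addr_ge0// !mulr_ge0.
rewrite -subr_ge0; apply: ltW.
apply: (@real_induction R 0 t (fun u => 0 < x u b - x u a)) => //.
  by rewrite subr_gt0.
move=> m /andP[m0 mt]; pose d := (x 0 b - x 0 a) / k.
have d0 : 0 < d by rewrite divr_gt0// subr_gt0.
have K1 : 0 < 2 * K + 1 by rewrite ltr_wpDl// mulr_ge0.
pose r := d / (2 * K + 1).
have r0 : 0 < r by exact: divr_gt0.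
(* The times [s] and [u] differ by less than [2 * r] and the gap is [K]-Lipschitz, so at least
   [d - 2 * K * r = r > 0] of it is left. *)
have dr : d = 2 * (K * r) + r by rewrite /r; field; rewrite gt_eqF.
exists r => //.
move=> s u s0 /andP[ms sm] /andP[mu um] ut xs.
have hs : 0 <= s <= t by lra.
have ds : d <= x s b - x s a.
  rewrite ler_pdivrMr// mulrC; have [_] := flow s a b hs la lb.
  by rewrite gtr0_norm ?subr_gt0// gtr0_norm.
have hu : 0 <= u <= t by lra.
have lipa := solution_lipschitz t0 xM la hs hu.
have lipb := solution_lipschitz t0 xM lb hs hu.
have us : K * (u - s) <= K * (2 * r) by rewrite ler_wpM2l//; lra.
have su : 0 <= u - s by lra.
move: lipa lipb; rewrite (ger0_norm su).
rewrite !ler_norml => /andP[_ A] /andP[B _].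
by have := mulrDl (W * (2 * M)) (W * (2 * M)) (u - s); rewrite -/K; lra.
Qed.

(** * Positions stay in the unit interval *)

Hypothesis x_init : forall a, label R a -> 0 <= x 0 a <= 1.

(** The sign [s] treats highest and lowest agents together; the tolerance [e] is there because the
    extremum need not be attained. *)
Lemma near_extremal (s e : R) : 0 < e -> s = 1 \/ s = -1 ->
  exists2 a, label R a & forall b, label R b -> s * x 0 b <= s * x 0 a + e.
Proof.
move=> e0 s1; pose S := [set s * x 0 a | a in label R].
have l0 : label R 0 by rewrite /label /= in_itv/= lexx ler01.
have supS : has_sup S.
  split; first by exists (s * x 0 0), 0.
  exists 1 => _ [a la <-]; have /andP[] := x_init la.
  by case: s1 => ->; lra.
have [_ [a la <-] sa] := sup_adherent e0 supS; exists a => // b lb.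
have : s * x 0 b <= sup S by apply: (ub_le_sup supS.2); exists b.
by lra.
Qed.

(** An agent [a] that is nearly extremal at time 0 remains within [k * e'] of being extremal, so its
    outward speed is at most [W * (k * e')]. Its drift up to time [t] and the distance from [a] to
    [b] add up to at most [e], by the choice of [e']. *)
Lemma solution_extremum (s c t b : R) : s = 1 \/ s = -1 ->
  (forall a, label R a -> s * x 0 a <= c) -> 0 <= t -> label R b ->
  s * x t b <= c.
Proof.
move=> s1 xc t0 lb; have [k k0 flow] := flow_bilipschitz t0.
apply/ler_addgt0Pr => e e0.
have Wt0 : 0 <= W * t by rewrite mulr_ge0.
have k1 : 0 < k * (W * t + 1) by rewrite mulr_gt0// ltr_wpDl.
pose e' := e / (k * (W * t + 1)); have e'0 : 0 < e' by exact: divr_gt0.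
have [a la xa] := near_extremal e'0 s1.
have ke0 : 0 <= k * e' by apply: mulr_ge0; apply: ltW.
(* Agents not beyond [a] initially are handled by monotonicity of the flow, those beyond [a] by the
   bi-Lipschitz bound. *)
have close u d : 0 <= u <= t -> label R d -> s * x u d <= s * x u a + k * e'.
  move=> ut ld; have u0 : 0 <= u by case/andP: ut.
  have [le_da|lt_ad] := leP (s * x 0 d) (s * x 0 a).
    suff : s * x u d <= s * x u a by lra.
    by case: s1 le_da => ->; rewrite ?mul1r ?mulN1r ?lerN2; apply: flow_monotone.
  have [+ _] := flow u a d ut la ld; have := xa _ ld.
  have sabs (r : R) : `|r| = `|s * r|.
    by case: s1 => ->; rewrite ?mul1r ?mulN1r ?normrN.
  have ad : 0 <= s * x 0 d - s * x 0 a by rewrite subr_ge0 ltW.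
  rewrite !(sabs (_ - _)) !mulrBr (ger0_norm ad).
  rewrite ler_norml => h1 /andP[_ h2].
  have : k * (s * x 0 d - s * x 0 a) <= k * e'.
    by rewrite (ler_wpM2l (ltW k0))//; lra.
  by lra.
(* The factor [- s] turns the lower bound on increments into an upper bound on the outward drift of
   [a]. *)
have : - (W * (k * e')) * (t - 0)
    <= ((- s) \*: (x ^~ a)) t - ((- s) \*: (x ^~ a)) 0.
  have [M xM] := x_bounded t0.
  apply: ac_increment_ge => //.
  - exact: mulr_ge0.
  - exact: (lipschitz_itv_ac (lipschitz_itvZ (- s) (solution_lipschitz t0 xM la))).
  - move: (x_derive la); apply: filterS => u xu /andP[u0 ut].
    exists (- s *: field u (x u a)); first by apply: is_deriveZ; exact: xu.
    have ut' : 0 <= u <= t by rewrite u0.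
    have infl d : label R d -> s * influence u (x u a) d <= W * (k * e').
      have /andP[w0 wW] := wt_bounded (x u a) (x u d) u0.
      move=> ld; have h := close u d ut' ld.
      rewrite /influence mulrCA.
      apply: (@le_trans _ _ (wt u (x u a) (x u d) * (k * e'))).
        by rewrite ler_wpM2l// mulrBr; lra.
      by rewrite ler_wpM2r.
    rewrite /GRing.scale/= mulNr lerN2; case: s1 infl => -> infl.
      by rewrite mul1r; apply: field_le => // d ld; rewrite -[leLHS]mul1r infl.
    rewrite mulN1r lerNl; apply: field_ge => // d ld.
    by rewrite lerNl -mulN1r infl.
rewrite /= /GRing.scale/= subr0 !mulNr => h.
have t0t : 0 <= t <= t by rewrite t0 lexx.
have := close t b t0t lb; have := xc _ la.
have : k * (W * t + 1) * e' = e by rewrite /e' mulrC divfK// gt_eqF.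
rewrite mulrDr mulr1 mulrDl.
have : W * (k * e') * t = k * (W * t) * e' by ring.
by lra.
Qed.

Lemma solution_range (t b : R) : 0 <= t -> label R b -> 0 <= x t b <= 1.
Proof.
move=> t0 lb; apply/andP; split.
  rewrite -oppr_le0 -mulN1r; apply: solution_extremum => //; first by right.
  by move=> a /x_init/andP[]; rewrite mulN1r oppr_le0.
rewrite -[leLHS]mul1r; apply: solution_extremum => //; first by left.
by move=> a /x_init/andP[]; rewrite mul1r.
Qed.

(** * Monotonicity of the total position of the lowest agents *)

(** Exchanging the two sums shows that the double sum is its own opposite. This is the discrete form
    of the cancellation of internal interactions. *)
Lemma antisymmetric_sum0 (n : nat) (m : 'I_n -> R) (g : 'I_n -> 'I_n -> R) :
  (forall i j, g i j = - g j i) ->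
  \sum_(i < n) m i * (\sum_(j < n) m j * g i j) = 0.
Proof.
move=> gN; set S := \sum_(i < n) _.
have : S = - S.
  rewrite {1}/S; under eq_bigr do rewrite mulr_sumr.
  rewrite exchange_big/= /S -sumrN; apply: eq_bigr => j _.
  rewrite mulr_sumr -sumrN; apply: eq_bigr => i _.
  by rewrite gN !mulrN mulrCA.
by lra.
Qed.

(** This is the first moment of the positions over [A]: their mean times the measure of [A], which
    makes sense for null sets too. *)
Definition mass (A : set R) (t : R) : R :=
  \int[lebesgue R]_(b in (A : set (lebR R))) x t b.

Lemma solution_integrable (t : R) (A : set (lebR R)) : 0 <= t ->
  measurable A -> A `<=` label R ->
  (lebesgue R).-integrable A (EFin \o (x t : lebR R -> R)).
Proof.
move=> t0 mA Al; have [M xM] := x_bounded t0.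
apply: (@bounded_integrable_label _ _ M) => //.
  by apply: measurable_funS (x_measurable t0) => //; exact: measurable_label.
by move=> b Ab; apply: xM; [rewrite t0 lexx | exact: Al].
Qed.

(** The cells have width [1 / N.+1] and are half-open, so the position 1 falls into the cell of
    index [N.+1]; hence [N.+2] cells. *)
Lemma initial_cells (A : set (lebR R)) (N : nat) :
  measurable A -> A `<=` label R ->
  exists E : nat -> set (lebR R), [/\
    forall i, measurable (E i), trivIset [set: nat] E,
    \big[setU/set0]_(i < N.+2) E i = A,
    forall i, E i `<=` A &
    forall i b b', E i b -> E i b' -> `|x 0 b - x 0 b'| <= N.+1%:R^-1].
Proof.
move=> mA Al; pose I i : interval R := `[i%:R / N.+1%:R, i.+1%:R / N.+1%:R[.
have N0 : 0 < N.+1%:R :> R by rewrite ltr0n.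
have inI b i : (x 0 b \in I i) = (i%:R <= x 0 b * N.+1%:R < i.+1%:R).
  by rewrite in_itv/= ler_pdivrMr// ltr_pdivlMr.
pose E i : set (lebR R) := A `&` (label R `&` x 0 @^-1` [set` I i]).
exists E; split.
- move=> i; apply: measurableI => //.
  by apply: (x_measurable (lexx 0)) => //; exact: measurable_label.
- move=> i j _ _ [b [[_ [_ /= bi]] [_ [_ /= bj]]]].
  move: bi bj; rewrite !inI => /andP[i1 i2] /andP[j1 j2].
  have := le_lt_trans i1 j2; have := le_lt_trans j1 i2; rewrite !ltr_nat; lia.
- rewrite -(bigcup_mkord _ E); apply/seteqP; split => [b [i _ []]//|b Ab].
  have lb := Al _ Ab; have /andP[b0 b1] := x_init lb.
  have xN0 : 0 <= x 0 b * N.+1%:R by rewrite mulr_ge0.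
  have /andP[tr1 tr2] := truncn_itv xN0.
  exists (Num.truncn (x 0 b * N.+1%:R)); last by split; rewrite //= inI tr1.
  rewrite /= -(ltr_nat R); apply: le_lt_trans tr1 _.
  apply: (@le_lt_trans _ _ N.+1%:R); last by rewrite ltr_nat.
  by rewrite ler_piMl// ltW.
- by move=> i b [].
- move=> i b b' [_ [_ /= bi]] [_ [_ /= bi']].
  move: bi bi'; rewrite !in_itv/= -[i.+1%:R]natr1 mulrDl mul1r.
  move: (i%:R / N.+1%:R : R) (N.+1%:R^-1 : R) => p q /andP[? ?] /andP[? ?].
  by rewrite ler_norml; lra.
Qed.

(** The mass is within [k * d] of a weighted sum [G] over one representative per cell. In the
    derivative of [G] the interactions between representatives cancel, the agents outside [A] stay
    above and contribute nonnegatively, and passing from integrals to sums costs at most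
    [C * k * d]. Finally [d] is arbitrarily small. *)
Lemma mass_nondecreasing (A : set (lebR R)) (s t : R) :
  measurable A -> A `<=` label R ->
  (forall a b, A a -> label R b -> ~ A b -> x 0 a <= x 0 b) ->
  0 <= s -> s <= t -> mass A s <= mass A t.
Proof.
move=> mA Al Alow s0 st; have t0 := le_trans s0 st.
have [k k0 flow] := flow_bilipschitz t0.
pose C := L * (2 * 1) + W; have C0 : 0 <= C by rewrite addr_ge0// !mulr_ge0.
have Afin := lebesgue_sub_label_lty mA Al.
have A1 := lebesgue_sub_label_le1 mA Al.
have A0 : 0 <= fine (lebesgue R A) by rewrite fine_ge0.
have x1 u b : 0 <= u -> label R b -> `|x u b| <= 1.
  by move=> u0 lb; have := solution_range u0 lb; rewrite ler_norml; lra.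
(* [B * d] is the total error: [C * k * d] per unit time for the derivative of [G], and [k * d] for
   each of the two comparisons of the mass with [G]. *)
pose B := C * k * t + 2 * k; have B0 : 0 <= B.
  by rewrite addr_ge0// !mulr_ge0// ltW.
apply/ler_addgt0Pr => e e0.
pose N := Num.truncn (B / e); pose d : R := N.+1%:R^-1.
have d0 : 0 < d by rewrite invr_gt0.
have Bd : B * d <= e.
  rewrite ler_pdivrMr ?ltr0n// mulrC -ler_pdivrMr// ltW//.
  by rewrite truncnS_gt.
have [E [mE tE EA EsubA Ed]] := initial_cells N mA Al.
have El i : E i `<=` label R by move=> b /EsubA/Al.
(* An empty cell is represented by the label 0, possibly outside [A]; this is harmless since its
   weight [m i] vanishes. *)
have /choice[rep repP] : forall i, exists a : R,
    label R a /\ forall b, E i b -> E i a.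
  move=> i.
  have [[a Ea]|nE] := pselect (exists a, E i a).
    exists a; split=> //; exact: El Ea.
  exists 0; split; first by rewrite /label /= in_itv/= lexx ler01.
  by move=> b Eb; case: nE; exists b.
have lrep i : label R (rep i) by have [] := repP i.
pose m i := fine (lebesgue R (E i)).
have m0 i : 0 <= m i by rewrite fine_ge0.
have Eclose u i b : 0 <= u <= t -> E i b -> `|x u b - x u (rep i)| <= k * d.
  move=> ut Eib; have [+ _] := flow u _ b ut (lrep i) (El _ _ Eib).
  move=> /le_trans; apply; rewrite ler_wpM2l ?(ltW k0)//.
  by apply: (Ed i) => //; exact: (repP i).2 Eib.
(* No factor for the measure of [A] appears, as that measure is at most 1. *)
have cells (f : R -> R) (h : nat -> R) (eta : R) : 0 <= eta ->
    (lebesgue R).-integrable A (EFin \o f) ->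
    (forall i b, E i b -> `|f b - h i| <= eta) ->
    `|\int[lebesgue R]_(b in A) f b - \sum_(i < N.+2) m i * h i| <= eta.
  move=> eta0 fint fh.
  have := @Rintegral_cells _ _ R (lebesgue R) E N.+2 f h eta mE tE.
  rewrite EA => /(_ Afin fint fh) /le_trans; apply.
  by rewrite -[leRHS]mulr1 ler_wpM2l.
have summ : \sum_(i < N.+2) m i <= 1.
  have := cells (cst 1) (cst 1) 0 (lexx _) (integrable_cst_EFin _ mA Afin).
  rewrite Rintegral_cst// mul1r; under eq_bigr do rewrite mulr1.
  move=> /(_ _); rewrite normr_le0 subr_eq0 => /(_ _)/eqP<-//.
  by move=> i b _; rewrite subrr normr0.
pose G : R -> R := \sum_(i < N.+2) (m i \*: (x ^~ (rep i))).
have GE u : G u = \sum_(i < N.+2) m i * x u (rep i) by rewrite /G fct_sumE.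
have kd0 : 0 <= k * d by rewrite mulr_ge0// ltW.
have massG u : 0 <= u <= t -> `|mass A u - G u| <= k * d.
  move=> ut; rewrite GE; apply: (cells (x u) (fun i => x u (rep i))) => //.
    by apply: solution_integrable => //; case/andP: ut.
  by move=> i b; exact: Eclose.
have xlip a : label R a -> lipschitz_itv 0 t (W * (2 * 1)) (x ^~ a).
  by move=> la; apply: solution_lipschitz => // u b /andP[u0 _]; exact: x1.
(* The field is split into the integral over [A], replaced by its cell sum, and the integral over
   the other agents, which is nonnegative and dropped. *)
have fieldA u i : 0 <= u <= t -> A (rep i) ->
    \sum_(j < N.+2) m j * influence u (x u (rep i)) (rep j) - C * (k * d)
    <= field u (x u (rep i)).
  move=> ut Ari; have u0 : 0 <= u by case/andP: ut.
  have infint (D : set (lebR R)) : measurable D -> D `<=` label R ->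
    (lebesgue R).-integrable D (EFin \o influence u (x u (rep i))).
    exact: influence_integrable.
  have lA : label R = A `|` (label R `\` A) by rewrite setDUK.
  have ml : measurable (label R : set (lebR R)) by exact: measurable_label.
  have mlA : measurable (label R `\` A : set (lebR R)) by exact: measurableD.
  have rest0 : 0 <= \int[lebesgue R]_(b in (label R `\` A : set (lebR R)))
      influence u (x u (rep i)) b.
    apply: Rintegral_ge0 => b [lb nAb]; apply: mulr_ge0.
      by have /andP[] := wt_bounded (x u (rep i)) (x u b) u0.
    by rewrite subr_ge0; apply: flow_monotone => //; exact: Alow.
  have := cells (influence u (x u (rep i)))
    (fun j => influence u (x u (rep i)) (rep j)) (C * (k * d)).
  move=> /(_ (mulr_ge0 C0 kd0) (infint _ mA Al)) H.
  have {H} : `|\int[lebesgue R]_(b in A) influence u (x u (rep i)) b -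
      \sum_(j < N.+2) m j * influence u (x u (rep i)) (rep j)| <= C * (k * d).
    apply: H => j b Ejb.
    apply: le_trans (influence_lip_target (M := 1) _ u0 _ _) _.
    - exact/x1/El/Ejb.
    - exact: x1.
    - by rewrite ler_wpM2l// Eclose.
  rewrite ler_norml /field lA Rintegral_setU//.
  - by move=> /andP[? _]; lra.
  - by rewrite -lA; exact: infint.
  - by apply/disj_setPS => b [Ab []].
have dG : - (C * k * d) * (t - s) <= G t - G s.
  apply: ac_increment_ge => //.
  - by rewrite -mulrA mulr_ge0.
  - apply: (@lipschitz_itv_ac _ _ _ (\sum_(i < N.+2) `|m i| * (W * (2 * 1)))).
    move=> u v hu hv; rewrite !GE -sumrB mulr_suml.
    apply: le_trans (ler_norm_sum _ _ _) _; apply: ler_sum => i _.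
    apply: (lipschitz_itvZ (m i) (xlip _ (lrep i))); lra.
  - have : {ae lebesgue R, forall u : R, forall i : 'I_N.+2, 0 <= u ->
      is_derive u (1 : R) (x ^~ (rep i)) (field u (x u (rep i)))}.
      by apply: filter_forall => i; exact: x_derive.
    apply: filterS => u xu /andP[su ut]; have u0 := le_trans s0 su.
    have ut' : 0 <= u <= t by rewrite u0.
    exists (\sum_(i < N.+2) m i *: field u (x u (rep i))).
      by apply: is_derive_sum => i; apply: is_deriveZ; exact: xu.
    pose y i := x u (rep i).
    have zero : \sum_(i < N.+2) m i *
        (\sum_(j < N.+2) m j * influence u (y i) (rep j)) = 0.
      apply: (@antisymmetric_sum0 N.+2 m
        (fun i j => influence u (y i) (rep j))) => i j.
      by rewrite /influence /y wt_sym//; ring.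
    (* The antisymmetric part sums to zero, and the weights add up to at most 1, so only the error
       [C * (k * d)] is left. *)
    apply: (@le_trans _ _ (\sum_(i < N.+2) m i *
        (\sum_(j < N.+2) m j * influence u (y i) (rep j) - C * (k * d)))).
      under eq_bigr do rewrite mulrBr.
      rewrite sumrB zero sub0r lerN2 -mulr_suml -mulrA.
      by rewrite -[leRHS]mul1r ler_wpM2r// mulr_ge0.
    apply: ler_sum => i _; rewrite /GRing.scale/=.
    have [[b Eib]|nE] := pselect (exists b, E i b).
      by rewrite ler_wpM2l//; apply: fieldA => //; apply/EsubA/((repP i).2 _ Eib).
    have -> : m i = 0; last by rewrite !mul0r.
    rewrite /m (_ : E i = set0) ?measure0//.
    by apply/seteqP; split => // b Eib; case: nE; exists b.
have := massG s; have := massG t; rewrite t0 s0 st lexx.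
move=> /(_ isT) ht /(_ isT) hs.
(* This allows [t - s] to be replaced by the larger [t] that occurs in [B]. *)
have : 0 <= C * k * d * s by do 3 ?[apply: mulr_ge0 => //]; exact: ltW.
move: Bd ht hs; rewrite /B !ler_norml mulrDl => Bd /andP[? ?] /andP[? ?].
have : C * k * t * d = C * k * d * t by ring.
lra.
Qed.

(** The mass is nondecreasing and bounded by 1, so its supremum is the limit. *)
Lemma mass_converges (A : set (lebR R)) :
  measurable A -> A `<=` label R ->
  (forall a b, A a -> label R b -> ~ A b -> x 0 a <= x 0 b) ->
  exists l : R, forall e : R, 0 < e ->
    exists2 T, 0 <= T & forall t, T <= t -> `|mass A t - l| <= e.
Proof.
move=> mA Al Alow; pose S := [set mass A t | t in [set t : R | 0 <= t]].
have Afin := lebesgue_sub_label_lty mA Al.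
have mass1 t : 0 <= t -> mass A t <= 1.
  move=> t0; have A1 := lebesgue_sub_label_le1 mA Al.
  apply: le_trans A1; rewrite -[leRHS]mul1r; apply: Rintegral_le_cst => //.
    exact: solution_integrable.
  by move=> b Ab; have /andP[] := solution_range t0 (Al _ Ab).
have supS : has_sup S.
  by split; [exists (mass A 0), 0 => /=|exists 1 => _ [t t0 <-]; exact: mass1].
exists (sup S) => e e0; have [_ [T /= T0 <-] ST] := sup_adherent e0 supS.
exists T => // t Tt; have t0 := le_trans T0 Tt.
have : mass A t <= sup S by apply: (ub_le_sup supS.2); exists t.
have := mass_nondecreasing mA Al Alow T0 Tt.
by rewrite ler_norml; lra.
Qed.

(** * Bands of initial positions and oscillating agents *)

Definition band (c1 c2 : R) : set (lebR R) :=
  [set b | label R b /\ c1 <= x 0 b <= c2].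

Lemma measurable_label_preimage (J : interval R) :
  measurable (label R `&` x 0 @^-1` [set` J] : set (lebR R)).
Proof.
by apply: (x_measurable (lexx 0)) => //; exact: measurable_label.
Qed.

Lemma measurable_band (c1 c2 : R) : measurable (band c1 c2).
Proof.
exact: (measurable_label_preimage `[c1, c2]).
Qed.

(** A band is the difference of two sets of lowest agents, [x 0 <= c2] and [x 0 < c1], whose masses
    both converge. *)
Lemma band_mass_converges (c1 c2 : R) : c1 <= c2 ->
  exists l : R, forall e : R, 0 < e ->
    exists2 T, 0 <= T & forall t, T <= t -> `|mass (band c1 c2) t - l| <= e.
Proof.
move=> c12.
pose A : set (lebR R) := label R `&` x 0 @^-1` [set` `]-oo, c1[].
pose B : set (lebR R) := label R `&` x 0 @^-1` [set` `]-oo, c2]].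
have mA : measurable A by exact: measurable_label_preimage.
have mB : measurable B by exact: measurable_label_preimage.
have Al : A `<=` label R by move=> b [].
have Bl : B `<=` label R by move=> b [].
have Alow a b : A a -> label R b -> ~ A b -> x 0 a <= x 0 b.
  move=> [_ /=]; rewrite in_itv/= => ac lb nAb.
  have [cb|bc] := leP c1 (x 0 b); first by lra.
  by case: nAb; split; rewrite //= in_itv.
have Blow a b : B a -> label R b -> ~ B b -> x 0 a <= x 0 b.
  move=> [_ /=]; rewrite in_itv/= => ac lb nBb.
  have [bc|cb] := leP (x 0 b) c2; last by lra.
  by case: nBb; split; rewrite //= in_itv.
have [lA HA] := mass_converges mA Al Alow.
have [lB HB] := mass_converges mB Bl Blow.
exists (lB - lA) => e e0; have e20 : 0 < e / 2 by lra.
have [T1 T10 H1] := HA _ e20; have [T2 T20 H2] := HB _ e20.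
exists (Num.max T1 T2); first by rewrite le_max T10.
move=> t; rewrite ge_max => /andP[T1t T2t].
have t0 := le_trans T10 T1t.
have BE : B = A `|` band c1 c2.
  apply/seteqP; split => [b [lb /=]|b [[lb /=]|[lb /andP[cb bc]]]].
  - rewrite in_itv/= => bc; have [cb|bc1] := leP c1 (x 0 b).
      by right; split => //; rewrite cb.
    by left; split => //=; rewrite in_itv.
  - by rewrite in_itv/= => bc; split => //=; rewrite in_itv/=; lra.
  - by split => //=; rewrite in_itv.
have massE : mass B t = mass A t + mass (band c1 c2) t.
  rewrite /mass BE Rintegral_setU//; first exact: measurable_band.
    by rewrite -BE; exact: solution_integrable.
  apply/disj_setPS => b [[_ /=]]; rewrite in_itv/= => bc [_ /andP[cb _]].
  by lra.
by have := H1 t T1t; have := H2 t T2t; rewrite massE !ler_norml; lra.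
Qed.

Definition oscillates (p q : R) (a : R) : Prop :=
  (forall T, 0 <= T -> exists2 t, T <= t & x t a < p) /\
  (forall T, 0 <= T -> exists2 t, T <= t & q < x t a).

(* The mean over the band lies between the two extreme trajectories, so its
   limit would be both at most [p] and at least [q]. *)
Lemma band_between_oscillating_null (p q a1 a2 : R) :
  p < q -> label R a1 -> label R a2 -> x 0 a1 <= x 0 a2 ->
  oscillates p q a1 -> oscillates p q a2 ->
  lebesgue R (band (x 0 a1) (x 0 a2)) = 0%E.
Proof.
move=> pq l1 l2 a12 [_ osc1] [osc2 _].
set D := band _ _; have mD : measurable D by exact: measurable_band.
have Dl : D `<=` label R by move=> b [].
have Dfin := lebesgue_sub_label_lty mD Dl.
have [l Hl] := band_mass_converges a12.
apply/eqP; rewrite -(@fineK _ (lebesgue R D)) ?ge0_fin_numE// eqe.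
have := fine_ge0 (measure_ge0 (lebesgue R) D).
set m := fine _; rewrite le_eqVlt eq_sym => /predU1P[->//|m0]; exfalso.
(* When the lowest agent [a1] is above [q] the mass exceeds [q * m], and when the highest agent [a2]
   is below [p] it is less than [p * m]. Two values within a quarter of [(q - p) * m] of [l] cannot
   be that far apart. *)
have e0 : 0 < (q - p) * m / 4 by rewrite divr_gt0// mulr_gt0// subr_gt0.
have [T T0 HT] := Hl _ e0.
have [t1 Tt1 x1] := osc1 T T0; have [t2 Tt2 x2] := osc2 T T0.
have t10 := le_trans T0 Tt1; have t20 := le_trans T0 Tt2.
have lo : x t1 a1 * m <= mass D t1.
  apply: Rintegral_ge_cst => //; first exact: solution_integrable.
  by move=> b [lb /andP[ab _]]; exact: flow_monotone.
have hi : mass D t2 <= x t2 a2 * m.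
  apply: Rintegral_le_cst => //; first exact: solution_integrable.
  by move=> b [lb /andP[_ ab]]; exact: flow_monotone.
have qm : q * m < x t1 a1 * m by rewrite ltr_pM2r.
have pm : x t2 a2 * m < p * m by rewrite ltr_pM2r.
have := HT _ Tt1; have := HT _ Tt2; rewrite !ler_norml -/D.
by rewrite !mulrBl; lra.
Qed.

(** An oscillating agent strictly between two others in initial position lies in a null band with
    rational ends, and there are countably many of these. The remaining ones are lowest or highest
    among the oscillating agents and occupy at most two initial positions. *)
Lemma oscillating_negligible (p q : R) : p < q ->
  (lebesgue R).-negligible
    ([set a | label R a /\ oscillates p q a] : set (lebR R)).
Proof.
move=> pq; set S := [set a | _].
have nullS a1 a2 : S a1 -> S a2 -> x 0 a1 <= x 0 a2 ->
    (lebesgue R).-negligible (band (x 0 a1) (x 0 a2)).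
  move=> [l1 o1] [l2 o2] a12; apply/negligibleP; first exact: measurable_band.
  exact: band_between_oscillating_null o1 o2.
(* This enumerates the pairs of rationals, with [(0, 0)] for numbers that code none. Bands that are
   not null are replaced by the empty set, so the union is null by construction. *)
pose F (n : nat) : set (lebR R) :=
  let rs := odflt (0, 0) (unpickle n : option (rat * rat)) in
  let D := band (ratr rs.1) (ratr rs.2) in
  if pselect ((lebesgue R).-negligible D) then D else set0.
have FN : (lebesgue R).-negligible (\bigcup_n F n).
  apply: negligible_bigcup => n; rewrite /F.
  by case: pselect => [pn|pn]; [exact: pn|exact: negligible_set0].
pose level (P : R -> Prop) : set (lebR R) :=
  [set b | label R b /\ exists a, [/\ S a, P a & x 0 b = x 0 a]].
(* A single initial position is a degenerate band, null by [nullS] with both agents equal. *)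
have levelN (P : R -> Prop) :
    (forall a a', S a -> S a' -> P a -> P a' -> x 0 a = x 0 a') ->
    (lebesgue R).-negligible (level P).
  move=> Puniq; have [[a [Sa Pa]]|none] := pselect (exists a, S a /\ P a).
    apply: negligibleS (nullS a a Sa Sa (lexx _)) => b [lb [a' [Sa' Pa' xb]]].
    by split => //; rewrite xb (Puniq _ _ Sa Sa' Pa Pa') lexx.
  apply: negligibleS (negligible_set0 _) => b [_ [a [Sa Pa _]]].
  by case: none; exists a.
pose minS a := forall a', S a' -> x 0 a <= x 0 a'.
pose maxS a := forall a', S a' -> x 0 a' <= x 0 a.
have minN : (lebesgue R).-negligible (level minS).
  apply: levelN => a a' Sa Sa' ma ma'; apply/eqP.
  by rewrite eq_le ma// ma'.
have maxN : (lebesgue R).-negligible (level maxS).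
  apply: levelN => a a' Sa Sa' ma ma'; apply/eqP.
  by rewrite eq_le ma// ma'.
apply: negligibleS (negligibleU FN (negligibleU minN maxN)) => a Sa.
have la : label R a by case: Sa.
have [mina|/existsNP[a1 /not_implyP[S1 /negP]]] := pselect (minS a).
  by right; left; split => //; exists a.
rewrite -ltNge => lt1.
have [maxa|/existsNP[a2 /not_implyP[S2 /negP]]] := pselect (maxS a).
  by right; right; split => //; exists a.
rewrite -ltNge => lt2; left.
have [r] := rat_in_itvoo lt1; rewrite in_itv/= => /andP[r1 r2].
have [s] := rat_in_itvoo lt2; rewrite in_itv/= => /andP[s1 s2].
exists (pickle (r, s)) => //; rewrite /F pickleK /=.
case: pselect => [pn|nN]; first by split => //; rewrite !ltW.
case: nN; apply: negligibleS (nullS a1 a2 S1 S2 (ltW (lt_trans lt1 lt2))).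
by move=> b [lb ?]; split => //; lra.
Qed.

End interaction_field.

(** * From the absence of oscillation to convergence *)

(** The set [S] of eventual lower bounds has the inferior limit of [f] as supremum. A rational [p]
    above it is not an eventual lower bound, so any rational [q > p] is an eventual upper bound;
    both are taken below [sup S + e]. *)
Lemma cvg_pinfty_no_oscillation (R : realType) (f : R -> R) :
  (forall t, 0 <= t -> 0 <= f t <= 1) ->
  (forall p q : rat, p < q ->
    (exists2 T, 0 <= T & forall t, T <= t -> ratr p <= f t) \/
    (exists2 T, 0 <= T & forall t, T <= t -> f t <= ratr q)) ->
  cvg (f t @[t --> +oo]).
Proof.
move=> f01 osc.
pose S := [set r | exists2 T, 0 <= T & forall t, T <= t -> r <= f t].
have S0 : S 0 by exists 0 => // t /f01/andP[].
have supS : has_sup S.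
  split; first by exists 0.
  exists 1 => r [T T0 rf]; apply: le_trans (rf T (lexx _)) _.
  by have /andP[] := f01 T T0.
apply/cvg_ex; exists (sup S); apply/cvgrPdist_le => e e0.
have [r [T1 T10 rf] Sr] := sup_adherent e0 supS.
have lt_se : sup S < sup S + e by rewrite ltrDl.
have [p] := rat_in_itvoo lt_se; rewrite in_itv/= => /andP[Sp pe].
have [q] := rat_in_itvoo pe; rewrite in_itv/= => /andP[pq qe].
have lt_pq : p < q by move: pq; rewrite ltr_rat.
have [[T T0 pf]|[T2 T20 fq]] := osc p q lt_pq.
  have : ratr p <= sup S by apply: (ub_le_sup supS.2); exists T.
  by rewrite leNgt Sp.
near=> t.
have T1t : T1 <= t by near: t; apply: nbhs_pinfty_ge; rewrite num_real.
have T2t : T2 <= t by near: t; apply: nbhs_pinfty_ge; rewrite num_real.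
by have := rf t T1t; have := fq t T2t; rewrite ler_norml; lra.
Unshelve. all: by end_near. Qed.

Theorem theorem1p4 (R : realType) (w : R -> R -> R -> R -> R -> R)
    (wt : R -> R -> R -> R)
    (hw : bounded_weight w)
    (hwt : forall t a b y z : R, time R t -> label R a -> label R b ->
       w t a b y z = wt t y z)
    (hsym : forall t y z : R, time R t -> wt t y z = wt t z y)
    (hLip : exists L : R, forall t y z u : R, time R t ->
       `|wt t y z - wt t y u| <= L * `|z - u|)
    (x : R -> R -> R) (hx : is_solution w x) :
  {ae lebesgue R, forall a : R, label R a -> cvg (x t a @[t --> +oo])}.
Proof.
have timeE (t : R) : time R t = (0 <= t) by rewrite /time/= in_itv/= andbT.
have l0 : label R 0 by rewrite /label/= in_itv/= lexx ler01.
have [_ [W wW]] := hw; have [L wL] := hLip.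
have [xm xs x0 xb] := hx.
have wt_bounded (t y z : R) : 0 <= t -> 0 <= wt t y z <= W.
  by rewrite -timeE => t0; rewrite -(hwt t 0 0)//; exact: wW.
have wt_sym (t y z : R) : 0 <= t -> wt t y z = wt t z y.
  by rewrite -timeE; exact: hsym.
have wt_lip (t y z u : R) : 0 <= t -> `|wt t y z - wt t y u| <= `|L| * `|z - u|.
  rewrite -timeE => t0; apply: le_trans (wL _ _ _ _ t0) _.
  by rewrite ler_wpM2r// ler_norm.
have x_measurable (t : R) : 0 <= t ->
    measurable_fun (label R : set (lebR R)) (x t : lebR R -> R).
  by rewrite -timeE; exact: xm.
have x_ac (a : R) : label R a -> forall T : R, 0 <= T ->
    absolutely_continuous_on 0 T (x ^~ a) by move=> /xs[].
have x_derive (a : R) : label R a -> {ae lebesgue R, forall t : R, 0 <= t ->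
    is_derive t (1 : R) (x ^~ a) (field wt x t (x t a))}.
  move=> la; have [_] := xs a la; apply: filterS => t xt t0.
  have t0' : time R t by rewrite timeE.
  (* On labels [w] coincides with [wt], so the velocity depends on [a] only through its position. *)
  have -> : field wt x t (x t a) = velocity w x t a; last exact: xt.
  apply: eq_Rintegral => b; rewrite inE => lb.
  by rewrite hwt.
have range := solution_range wt_bounded wt_sym (normr_ge0 L) wt_lip
  x_measurable xb x_ac x_derive x0.
have oscN := oscillating_negligible wt_bounded wt_sym (normr_ge0 L) wt_lip
  x_measurable xb x_ac x_derive x0.
(* Coding pairs of rationals by numbers reduces the union over all [p < q] to a countable one. *)
pose pq n := odflt (0, 0) (unpickle n : option (rat * rat)).
have : {ae lebesgue R, forall a : R, forall n, (pq n).1 < (pq n).2 ->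
    ~ (label R a /\ oscillates x (ratr (pq n).1) (ratr (pq n).2) a)}.
  apply: ae_foralln => n; have [lt_pq|] := boolP ((pq n).1 < (pq n).2); last first.
    by move=> _; apply: aeW.
  have pqR : ratr (pq n).1 < ratr (pq n).2 :> R by rewrite ltr_rat.
  apply: negligibleS (oscN _ _ pqR) => a /= na.
  by apply: contrapT => nosc; apply: na.
apply: filterS => a nosc la; apply: cvg_pinfty_no_oscillation.
  by move=> t t0; exact: range.
move=> p q lt_pq; apply: contrapT => /not_orP[n1 n2].
have := nosc (pickle (p, q)); rewrite /pq pickleK/= => /(_ lt_pq); apply.
split => //; split => T T0; apply: contrapT => nex.
  apply: n1; exists T => // t Tt; rewrite leNgt; apply/negP => xp.
  by apply: nex; exists t.
apply: n2; exists T => // t Tt; rewrite leNgt; apply/negP => xp.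
by apply: nex; exists t.
Qed.
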